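(* There are absolute constants $C,c>0$ such that the following holds. Let $n,t\ge 2$ be integers and $p\in[1/t,1]$, with $n\ge C t^2$. Let $\mathcal{ALG}$ be an $\ell$-pass streaming algorithm with $s$ bits of memory which distinguishes between $\mathrm{Uniform}$ and $\mathrm{Planted}_p$ with error at most $1/3$. Then $$\ell\, p^2\, s\, t\,\log(t)\ \ge\ c .$$
   Context: Streams are sequences $X=(X_1,\ldots,X_t)\in[n]^t$. $\mathrm{Uniform}$ is the uniform distribution on $[n]^t$. $\mathrm{Planted}_p$ (the planted needle distribution with needle probability $p$) is sampled as follows: choose a uniform ''needle'' $x\in[n]$; then independently for each position $i\in[t]$, with probability $p$ set $X_i=x$, and otherwise sample $X_i\in[n]$ uniformly. An $\ell$-pass streaming algorithm with $s$ bits of memory reads the stream $X_1,\ldots,X_t$ in order $\ell$ times, keeping only an $s$-bit memory state between reading consecutive elements, and outputs a bit at the end. It distinguishes between distributions $D_0,D_1$ with error $\delta$ if, when the stream is drawn from $D_b$ for a uniformly random $b\in\{0,1\}$, its output equals $b$ with probability at least $1-\delta$. Logarithms are base 2. *)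

(* Defs.v *)
From HB Require Import structures.
From mathcomp Require Import all_boot all_order all_algebra.
From mathcomp Require Import all_classical all_reals all_analysis.
From mathcomp Require Import Rstruct.
Set Implicit Arguments. Unset Strict Implicit. Unset Printing Implicit Defensive.
Import Order.TTheory GRing.Theory Num.Theory.
Local Open Scope ring_scope.

Notation RR := Rdefinitions.R.

Definition stream (n t : nat) := {ffun 'I_t -> 'I_n}.

Definition log2 (x : RR) : RR := ln x / ln 2.

Definition uniform_pmf (n t : nat) (X : stream n t) : RR := (n%:R ^+ t)^-1.

(* Probability mass of X under Planted_p: a uniform needle x in [n]; each
   position independently equals x w.p. p, and is otherwise uniform in [n]. *)
Definition planted_pmf (n t : nat) (p : RR) (X : stream n t) : RR :=
  (n%:R)^-1 * \sum_(x : 'I_n)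
     \prod_(i : 'I_t) (p * (X i == x)%:R + (1 - p) * (n%:R)^-1).

(* A (possibly randomized, non-uniform) multi-pass streaming algorithm with
   s bits of memory: memory states are 'I_(2^s) (= {0,1}^s).  A random seed
   w is drawn from a finite probability space (Omega, mu) before the run;
   the initial state, each transition (which may depend on the pass number
   j and the position i being read) and the final output bit may depend on
   the seed.  Between reading consecutive elements only the s-bit state is
   kept. *)
Record streaming_alg (n s : nat) (Omega : finType) := StreamingAlg {
  alg_init : Omega -> 'I_(2^s);
  alg_step : Omega -> nat -> nat -> 'I_(2^s) -> 'I_n -> 'I_(2^s);
  alg_out  : Omega -> 'I_(2^s) -> bool }.

Definition run_pass (n s t : nat) (Omega : finType)
  (A : streaming_alg n s Omega) (w : Omega) (j : nat) (X : stream n t)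
  (st : 'I_(2^s)) : 'I_(2^s) :=
  foldl (fun st (i : 'I_t) => alg_step A w j (val i) st (X i)) st (enum 'I_t).

Definition run (n s t ell : nat) (Omega : finType)
  (A : streaming_alg n s Omega) (w : Omega) (X : stream n t) : bool :=
  alg_out A w (iteri ell (fun j st => run_pass A w j X st) (alg_init A w)).

Definition is_distr (Omega : finType) (mu : Omega -> RR) : Prop :=
  (forall w, 0 <= mu w) /\ \sum_(w : Omega) mu w = 1.

(* Probability that the algorithm outputs the correct bit b, where b is
   uniform in {0,1}, the stream is drawn from D_0 = Uniform if b = 0 and
   from D_1 = Planted_p if b = 1, and the seed is drawn from mu. *)
Definition success_prob (n s t ell : nat) (Omega : finType)
  (A : streaming_alg n s Omega) (mu : Omega -> RR) (p : RR) : RR :=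
  \sum_(w : Omega) mu w *
    ((1 / 2) * \sum_(X : stream n t) uniform_pmf X * (~~ run ell A w X)%:R
   + (1 / 2) * \sum_(X : stream n t) planted_pmf p X * (run ell A w X)%:R).

Definition distinguishes (n s t ell : nat) (Omega : finType)
  (A : streaming_alg n s Omega) (mu : Omega -> RR) (p delta : RR) : Prop :=
  is_distr mu /\ 1 - delta <= success_prob t ell A mu p.

(* Main.v *)
Require Import Defs.
From HB Require Import structures.
From mathcomp Require Import all_boot all_order all_algebra.
From mathcomp Require Import all_classical all_reals all_analysis.
From mathcomp Require Import Rstruct.
From mathcomp Require Import zify ring lra.
Import Order.TTheory GRing.Theory Num.Theory.
Local Open Scope ring_scope.

Set Implicit Arguments.
Unset Strict Implicit.
Unset Printing Implicit Defensive.

(* Planted_p is the law obtained by selecting each position with probability 2p and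
   then planting the needle x at each selected position with probability 1/2.  Fix the
   selected set S and enclose its elements in pairwise disjoint blocks, one each.  Given
   the memory states at the block boundaries, the likelihood ratio of this law to the
   uniform one is a product over i in S of factors (1 + r_i) / 2, where r_i is the ratio
   for fixing X_i = x.  Hence the relative entropy with respect to the uniform law is
   additive over S, and the 1/2 keeps each term below the mutual information between
   X_i and the boundary states.  These informations sum to at most ell * s bits over the
   positions of one block.

   The block of i is the largest dyadic interval meeting S only in i.  It has level m
   only if S contains another element of the interval of i at level m + 1, which for
   i in S happens with probability O(p^2 2^m), while there are O(t / 2^m) blocks at
   level m.  Each of the O(log t) levels thus contributes O(ell s p^2 t) to the expected
   relative entropy, which has to be bounded below by a constant. *)

(** * Logarithms *)

Section LnBounds.
Variable R : realType.
Implicit Types x y k : R.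

Lemma ln_le_subr1 y : 0 < y -> ln y <= y - 1.
Proof. by move=> y0; have := @le_ln1Dx R (y - 1); rewrite subrKC; apply; lra. Qed.

Lemma ln_ge_subV y : 0 < y -> 1 - y^-1 <= ln y.
Proof.
move=> y0; have := @ln_le_subr1 y^-1; rewrite invr_gt0 lnV ?posrE// => /(_ y0).
lra.
Qed.

Lemma ln_le_scaled k y : 0 < k -> 0 < y -> ln y <= y / k - 1 + ln k.
Proof.
move=> k0 y0; rewrite -lerBlDr -ln_div ?posrE//.
exact/ln_le_subr1/divr_gt0.
Qed.

Lemma ln_prod (I : Type) (r : seq I) (P : pred I) (f : I -> R) :
  (forall i, P i -> 0 < f i) ->
  ln (\prod_(i <- r | P i) f i) = \sum_(i <- r | P i) ln (f i).
Proof.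
move=> f0; suff [] : 0 < \prod_(i <- r | P i) f i /\
  ln (\prod_(i <- r | P i) f i) = \sum_(i <- r | P i) ln (f i) by [].
elim/big_rec2: _ => [|i y1 y2 /f0 fi [y0 <-]]; first by rewrite ln1.
by rewrite lnM ?posrE// mulr_gt0.
Qed.

(** Put [x = r ^+ 2] and use [1 - y^-1 <= ln y] at [(1 + x) / 2] and at [r]: what remains is
    [0 <= (r - 1) ^+ 4 / (2 * (1 + r ^+ 2))]. The slope [3 / 2] matches derivatives at 1, and the
    linear term will vanish on average because ratios have mean 1. *)
Lemma Nln_half_le x : 0 <= x -> - ln ((1 + x) / 2) <= x * ln x - 3 / 2 * (x - 1).
Proof.
move=> x0; have h0 : 0 < (1 + x) / 2 by lra.
have := ln_ge_subV h0; move: x0 h0; rewrite le_eqVlt => /predU1P[<- _|x0 h0].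
  rewrite addr0 invf_div divr1 mul0r; lra.
have s0 : 0 < Num.sqrt x by rewrite sqrtr_gt0.
rewrite -(sqr_sqrtr (ltW x0)); move: (Num.sqrt x) s0 => r r0 h.
rewrite lnXn// (mulr2n (ln r)); have := ln_ge_subV r0 => hr.
have h1 : r - 1 <= r * ln r.
  by rewrite -(ler_pM2l r0) in hr; move: hr; rewrite mulrBr mulr1 divff ?gt_eqF.
have h2 : r * (r - 1) <= r * (r * ln r) by rewrite ler_pM2l.
suff : 3 / 2 * (r ^+ 2 - 1) - 2 * (r * (r - 1)) <= 1 - ((1 + r ^+ 2) / 2)^-1.
  move: h h2; move: (ln ((1 + r ^+ 2) / 2)) ((1 + r ^+ 2) / 2)^-1 (ln r) => u v w h h2 h3.
  have -> : r ^+ 2 * (w + w) = 2 * (r * (r * w)) by ring.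
  lra.
have d0 : 0 < 1 + r ^+ 2 by have := sqr_ge0 r; lra.
rewrite -subr_ge0.
have -> : 1 - ((1 + r ^+ 2) / 2)^-1 - (3 / 2 * (r ^+ 2 - 1) - 2 * (r * (r - 1)))
  = (r - 1) ^+ 2 ^+ 2 / (2 * (1 + r ^+ 2)) by field; rewrite gt_eqF.
by rewrite divr_ge0 ?sqr_ge0//; lra.
Qed.

End LnBounds.

(** * Passes and block-consistent changes *)

Section Passes.
Variables (t : nat) (V St : finType).
(* Each of the [ell] passes runs over the positions below [T]; those from [t] on
   leave the memory unchanged, so that [T] can later be a power of 2 above [t]. *)
Variables (step : nat -> nat -> St -> V -> St) (init : St) (T ell : nat).
Local Notation str := {ffun 'I_t -> V}.
Implicit Types (X Y Z : str) (i : 'I_t) (a b c j m : nat) (s : St).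

Definition read j X s (m : nat) :=
  if insub m is Some i then step j m s (X (i : 'I_t)) else s.

Definition segment j X s a b := foldl (read j X) s (index_iota a b).

Definition start X j := iteri j (fun j s => segment j X s 0 T) init.

Definition state X j m := segment j X (start X j) 0 m.

Lemma segment_cat j X s a b c : (a <= b)%N -> (b <= c)%N ->
  segment j X s a c = segment j X (segment j X s a b) b c.
Proof.
move=> ab bc; rewrite /segment -foldl_cat /index_iota.
have -> : (c - a = (b - a) + (c - b))%N by lia.
by rewrite iotaD; congr (foldl _ _ (_ ++ iota _ _)); lia.
Qed.

Lemma segment_full j X s : (t <= T)%N ->
  segment j X s 0 T = foldl (fun s i => step j i s (X i)) s (enum 'I_t).
Proof.
move=> tT; rewrite (@segment_cat _ _ _ 0 t T)//.
have -> : segment j X s 0 t = foldl (fun s i => step j i s (X i)) s (enum 'I_t).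
  rewrite /segment /index_iota subn0 -val_enum_ord.
  by elim: (enum 'I_t) s => //= i r IH s; rewrite IH /read valK.
move: (foldl _ _ _) => u; rewrite /segment.
have : all (leq t) (index_iota t T).
  by apply/allP => m; rewrite mem_index_iota => /andP[].
elim: (index_iota t T) => //= m r IH /andP[tm /IH].
by rewrite /read insubN// -leqNgt.
Qed.

Lemma eq_segment j X Y s a b :
  (forall i, (a <= i < b)%N -> X i = Y i) -> segment j X s a b = segment j Y s a b.
Proof.
move=> XY; rewrite /segment.
have : forall m, m \in index_iota a b -> (a <= m < b)%N.
  by move=> m; rewrite mem_index_iota.
elim: index_iota s => //= m r IH s ab.
rewrite -IH; last by move=> k kr; apply: ab; rewrite inE kr orbT.
congr foldl; rewrite /read; case: insubP => // i _ im.
by rewrite XY// im ab// inE eqxx.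
Qed.

Definition splice a b X Y : str :=
  [ffun i : 'I_t => if (a <= i < b)%N then Y i else X i].

Definition agree a b X Y := forall i, (a <= i < b)%N -> X i = Y i.

(* [consistent a b X Y]: with the positions [a, b) of [X] overwritten by those
   of [Y], every pass still crosses the block from [state X j a] to [state X j b]. *)
Definition consistent a b X Y :=
  [forall j : 'I_ell, segment j Y (state X j a) a b == state X j b].

Definition invariant a b (A : Type) (F : str -> A) :=
  forall X Y, consistent a b X Y -> F (splice a b X Y) = F X.

(** Swapping the block contents of two streams is thus an involution on pairs, the change of
    variables behind the exchange arguments below. *)
Lemma spliceK a b X Y : splice a b (splice a b X Y) (splice a b Y X) = X.
Proof. by apply/ffunP => i; rewrite !ffunE; case: (a <= i < b)%N. Qed.

Lemma agree_splice a b X Y : agree a b (splice a b X Y) Y.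
Proof. by move=> i iab; rewrite ffunE iab. Qed.

Lemma agree_sym a b X Y : agree a b X Y -> agree a b Y X.
Proof. by move=> XY i /XY. Qed.

Lemma state_cat X j a b : (a <= b)%N -> state X j b = segment j X (state X j a) a b.
Proof. by move=> ab; rewrite /state -segment_cat. Qed.

Lemma consistent_refl a b X : (a <= b)%N -> consistent a b X X.
Proof. by move=> ab; apply/forallP => j; rewrite -state_cat. Qed.

Lemma consistent_agree a b X Y Z : agree a b Y Z ->
  consistent a b X Y = consistent a b X Z.
Proof. by move=> YZ; apply: eq_forallb => j; rewrite (eq_segment _ _ YZ). Qed.

Section Block.
Variables (a b : nat).
Hypotheses (ab : (a <= b)%N) (bT : (b <= T)%N).

(** Induction on the passes: a pass reaches [a] in equal states, leaves the block in equal states by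
    hypothesis, and then reads equal symbols up to [T]. *)
Lemma eq_state_outside X Z :
  (forall i, ~~ (a <= i < b)%N -> Z i = X i) ->
  (forall j, (j < ell)%N -> state Z j a = state X j a -> state Z j b = state X j b) ->
  forall j, (j <= ell)%N -> start Z j = start X j /\
   ((j < ell)%N -> forall m, (m <= a)%N || (b <= m)%N -> state Z j m = state X j m).
Proof.
move=> ZX Zb; have aux j : start Z j = start X j ->
    (j < ell)%N -> forall m, (m <= a)%N || (b <= m)%N -> state Z j m = state X j m.
  move=> Sj jl.
  have low m : (m <= a)%N -> state Z j m = state X j m.
    move=> ma; rewrite /state Sj; apply: eq_segment => i im.
    by apply: ZX; lia.
  move=> m /orP[/low //|bm].
  rewrite !(@state_cat _ _ b m)// Zb ?low//.
  by apply: eq_segment => i im; apply: ZX; lia.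
elim=> [|j IH] jl; first by split=> // l0; apply: aux.
have [Sj stj] := IH (ltnW jl).
have S1 : start Z j.+1 = start X j.+1 by apply: (stj jl T); rewrite bT orbT.
by split=> //; apply: aux.
Qed.

Lemma state_splice X Y : consistent a b X Y ->
  forall j, (j <= ell)%N -> start (splice a b X Y) j = start X j /\
   ((j < ell)%N -> forall m, (m <= a)%N || (b <= m)%N ->
      state (splice a b X Y) j m = state X j m).
Proof.
move=> /forallP cXY; apply: eq_state_outside.
  by move=> i /negbTE iab; rewrite ffunE iab.
move=> j jl Sa; rewrite (@state_cat _ _ a b)// Sa.
rewrite (eq_segment _ _ (@agree_splice a b X Y)).
exact: (eqP (cXY (Ordinal jl))).
Qed.

Lemma invariant_start (A : Type) (f : St -> A) : invariant a b (fun X => f (start X ell)).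
Proof. by move=> X Y cXY /=; rewrite (state_splice cXY (leqnn _)).1. Qed.

Lemma consistent_splice c d X Y : (c <= a)%N || (b <= c)%N -> (d <= a)%N || (b <= d)%N ->
  consistent a b X Y -> consistent c d (splice a b X Y) =1 consistent c d X.
Proof.
move=> ca da cXY Z; apply: eq_forallb => j.
by have [_ st] := state_splice cXY (ltnW (ltn_ord j)); rewrite !st.
Qed.

Lemma consistent_splice_self X Y :
  consistent a b X Y -> consistent a b (splice a b X Y) =1 consistent a b X.
Proof. by apply: consistent_splice; rewrite leqnn ?orbT. Qed.

Lemma consistent_swap X Y :
  consistent a b (splice a b X Y) (splice a b Y X) = consistent a b X Y.
Proof.
have imp X1 Y1 : consistent a b X1 Y1 ->
    consistent a b (splice a b X1 Y1) (splice a b Y1 X1).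
  move=> c1; rewrite consistent_splice_self// (@consistent_agree _ _ _ _ X1).
    exact: consistent_refl.
  exact: agree_splice.
by apply/idP/idP => /imp; rewrite ?spliceK.
Qed.

Definition exit_states X : {ffun 'I_ell -> St} := [ffun j : 'I_ell => state X j b].

(** With the contents outside the block fixed, the exit states of earlier passes determine where the
    next pass enters. Exit states alone therefore fix the class, so that [ell] states suffice
    instead of [2 * ell]. *)
Lemma exit_states_consistent X Y Y' :
  exit_states (splice a b X Y) = exit_states (splice a b X Y') ->
  consistent a b (splice a b X Y) =1 consistent a b (splice a b X Y').
Proof.
move=> /ffunP ex Z; apply: eq_forallb => j.
have [||_ st] := @eq_state_outside (splice a b X Y') (splice a b X Y) _ _ j (ltnW (ltn_ord j)).
- by move=> i /negbTE iab; rewrite !ffunE iab.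
- by move=> k kl _; have := ex (Ordinal kl); rewrite !ffunE.
by rewrite !st ?leqnn ?orbT.
Qed.

End Block.

(** * Information about a block *)

Section Information.
Variable R : realType.
Hypothesis V_gt0 : (0 < #|V|)%N.
Implicit Types (F h : str -> R) (x : V).

Lemma natr_cardV_gt0 : 0 < #|V|%:R :> R.
Proof. by rewrite ltr0n. Qed.

Lemma natr_card_str_gt0 : 0 < #|{: str}|%:R :> R.
Proof. by rewrite ltr0n card_ffun expn_gt0 V_gt0. Qed.

(** Whole streams are counted although consistency sees only the block; the common factor from the
    other positions cancels in [cond_avg] when [h] depends on the block only. *)
Definition class_size a b X : R := \sum_(Y | consistent a b X Y) 1.

Lemma sum_class_const a b X (u : R) :
  \sum_(Y | consistent a b X Y) u = u * class_size a b X.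
Proof. by rewrite mulr_sumr; apply: eq_bigr => Y _; rewrite mulr1. Qed.

Definition cond_avg a b h X : R :=
  (\sum_(Y | consistent a b X Y) h Y) / class_size a b X.

Lemma class_size_gt0 a b X : (a <= b)%N -> 0 < class_size a b X.
Proof.
move=> ab; rewrite /class_size (bigD1 X) ?consistent_refl//=.
by rewrite ltr_pwDl// sumr_ge0.
Qed.

Lemma sum_splice a b F :
  \sum_X \sum_Y F (splice a b X Y) = #|{: str}|%:R * \sum_X F X.
Proof.
transitivity (\sum_(X : str) \sum_(Y : str) F X).
  rewrite !pair_bigA/=.
  pose h (p : str * str) := (splice a b p.1 p.2, splice a b p.2 p.1).
  have hK : involutive h by case=> X Y; rewrite /h/= !spliceK.
  by rewrite [RHS](reindex_inj (inv_inj hK)).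
rewrite mulr_sumr; apply: eq_bigr => X _.
by rewrite sumr_const mulr_natl.
Qed.

Lemma cond_avg_ge0 a b h X : (forall Y, 0 <= h Y) -> 0 <= cond_avg a b h X.
Proof. by move=> h0; apply: divr_ge0; apply: sumr_ge0. Qed.

Section BlockAverage.
Variables (a b : nat).
Hypotheses (ab : (a <= b)%N) (bT : (b <= T)%N).

Lemma invariant_cond_avg c d h : (c <= a)%N || (b <= c)%N -> (d <= a)%N || (b <= d)%N ->
  invariant a b (cond_avg c d h).
Proof.
move=> ca da X Y cXY; rewrite /cond_avg /class_size.
have cE := consistent_splice ab bT ca da cXY.
by rewrite !(eq_bigl _ _ cE).
Qed.

Lemma invariant_class_size : invariant a b (class_size a b).
Proof.
move=> X Y cXY; rewrite /class_size.
by rewrite (eq_bigl _ _ (consistent_splice_self ab bT cXY)).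
Qed.

(* Exchanging the block contents of two consistent streams turns the conditional
   average of [h] into [h] itself. *)
Lemma sum_mul_cond_avg F h : invariant a b F ->
  (forall X Y, agree a b X Y -> h X = h Y) ->
  \sum_X F X * cond_avg a b h X = \sum_X F X * h X.
Proof.
move=> Finv hloc; pose D := class_size a b.
transitivity (\sum_X \sum_(Y | consistent a b X Y) F X * h Y / D X).
  by apply: eq_bigr => X _; rewrite /cond_avg mulrA mulr_sumr mulr_suml.
transitivity (\sum_X \sum_(Y | consistent a b X Y) F X * h X / D X); last first.
  apply: eq_bigr => X _.
  by rewrite sum_class_const mulfVK// gt_eqF// class_size_gt0.
rewrite !(pair_big_dep xpredT).
pose g (p : str * str) := (splice a b p.1 p.2, splice a b p.2 p.1).
have gK : involutive g by case=> X Y; rewrite /g/= !spliceK.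
rewrite [RHS](reindex_inj (inv_inj gK))/=.
apply: eq_big => [[X Y]/=|[X Y]/= cXY]; first by rewrite consistent_swap.
rewrite Finv// /D invariant_class_size//; congr (_ * _ / _).
exact/hloc/agree_sym/agree_splice.
Qed.

Lemma cond_avg_affine h X (u v : R) :
  cond_avg a b (fun Y => u + v * h Y) X = u + v * cond_avg a b h X.
Proof.
rewrite /cond_avg big_split/= mulrDl -mulr_sumr mulrA; congr (_ + _).
by rewrite sum_class_const mulfK// gt_eqF// class_size_gt0.
Qed.

Lemma sum_cond_avg (I : finType) (h : I -> str -> R) X (u : R) :
  (forall Y, \sum_k h k Y = u) -> \sum_k cond_avg a b (h k) X = u.
Proof.
move=> hu; rewrite -mulr_suml exchange_big/=.
under eq_bigr do rewrite hu.
by rewrite sum_class_const mulfK// gt_eqF// class_size_gt0.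
Qed.

End BlockAverage.

Definition density i x Y : R := #|V|%:R * (Y i == x)%:R.

(** For a position [i] of the block: [#|V|] times the conditional probability that it holds [x],
    given the boundary states in all passes. *)
Definition ratio a b i x X : R := cond_avg a b (density i x) X.

Lemma density_ge0 i x Y : 0 <= density i x Y.
Proof. by rewrite mulr_ge0. Qed.

Lemma ratio_ge0 a b i x X : 0 <= ratio a b i x X.
Proof. by apply: cond_avg_ge0 => Y; exact: density_ge0. Qed.

Lemma sum_mul_density i Y (f : V -> R) : \sum_x f x * density i x Y = #|V|%:R * f (Y i).
Proof.
rewrite (bigD1 (Y i))//= /density eqxx mulr1 big1 ?addr0 1?mulrC// => x xi.
by rewrite eq_sym (negbTE xi) !mulr0.
Qed.

Lemma sum_ratio a b i X : (a <= b)%N -> \sum_x ratio a b i x X = #|V|%:R.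
Proof.
move=> ab; apply: (sum_cond_avg ab) => Y.
rewrite -[RHS]mulr1 -(sum_mul_density i Y (fun=> 1)).
by apply: eq_bigr => x _; rewrite mul1r.
Qed.

Lemma ratio_self_gt0 a b i X : (a <= b)%N -> 0 < ratio a b i (X i) X.
Proof.
move=> ab; rewrite /ratio /cond_avg divr_gt0 ?class_size_gt0//.
rewrite (bigD1 X) ?consistent_refl//= ltr_pwDl//.
  by rewrite /density eqxx mulr1 natr_cardV_gt0.
by apply: sumr_ge0 => Y _; exact: density_ge0.
Qed.

(* Average over [X] and [x] of the logarithmic loss at position [i] of the
   block [a, b), for the density in which [i] is fixed to [x] with probability 1/2. *)
Definition deficit a b i : R :=
  (\sum_X \sum_x - ln ((1 + ratio a b i x X) / 2)) / (#|{: str}|%:R * #|V|%:R).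

(** Jensen's inequality, in the form [ln y <= y - 1]: the ratios average to 1 over [x]. *)
Lemma deficit_ge0 a b i : (a <= b)%N -> 0 <= deficit a b i.
Proof.
move=> ab; rewrite divr_ge0// ?mulr_ge0//; apply: sumr_ge0 => X _.
apply: (@le_trans _ _ (\sum_x (1 - ratio a b i x X) / 2)).
  rewrite -mulr_suml big_split/= sumrN sum_ratio// sumr_const.
  by rewrite subrr mul0r.
apply: ler_sum => x _; have r0 := ratio_ge0 a b i x X.
have : 0 < (1 + ratio a b i x X) / 2 by lra.
by move/ln_le_subr1; lra.
Qed.

Section BlockInformation.
Variables (a b : nat).
Hypotheses (ab : (a <= b)%N) (bT : (b <= T)%N).

Definition block_ratio X Y : R := \prod_(i < t | (a <= i < b)%N) ratio a b i (Y i) X.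

Lemma sum_block_ratio X : \sum_Y block_ratio X Y = #|{: str}|%:R.
Proof.
pose f i x : R := if (a <= i < b)%N then ratio a b i x X else 1.
transitivity (\sum_(Y : str) \prod_i f i (Y i)).
  by apply: eq_bigr => Y _; rewrite /block_ratio big_mkcond.
rewrite -bigA_distr_bigA card_ffun natrX.
transitivity (\prod_(i < t) (#|V|%:R : R)); last by rewrite prodr_const.
apply: eq_bigr => i _; rewrite /f; case: (a <= i < b)%N; first exact: sum_ratio.
by rewrite sumr_const.
Qed.

Lemma block_ratio_ge0 X Y : 0 <= block_ratio X Y.
Proof. by apply: prodr_ge0 => i _; exact: ratio_ge0. Qed.

(* For fixed contents outside the block there are at most #|St| ^ ell classes. *)
Lemma sum_block_ratio_diag :
  \sum_X block_ratio X X <= #|{: str}|%:R * (#|St| ^ ell)%:R.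
Proof.
rewrite -(ler_pM2l natr_card_str_gt0) -(sum_splice a b (fun X => block_ratio X X)).
rewrite [leRHS]mulr_natl -sumr_const; apply: ler_sum => X _.
rewrite (eq_bigr (fun Y => block_ratio (splice a b X Y) Y)); last first.
  by move=> Y _; apply: eq_bigr => i iab; rewrite ffunE iab.
rewrite (partition_big (fun Y => exit_states b (splice a b X Y)) xpredT)//=.
have -> : (#|St| ^ ell)%N = #|{: {ffun 'I_ell -> St}}| by rewrite card_ffun card_ord.
rewrite mulr_natr -sumr_const.
apply: ler_sum => m _.
(* All [Y] with exit states [m] share the class of one representative [Y0]. Freezing the ratios at
   [Y0] leaves part of a sum that [sum_block_ratio] evaluates. *)
case: (pickP (fun Y => exit_states b (splice a b X Y) == m)) => [Y0 /eqP Y0m|none].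
  apply: (@le_trans _ _ (\sum_Y block_ratio (splice a b X Y0) Y)); last first.
    by rewrite sum_block_ratio.
  rewrite [leLHS]big_mkcond; apply: ler_sum => Y _.
  case: eqP => [Ym|_]; last exact: block_ratio_ge0.
  rewrite le_eqVlt; apply/orP/or_introl/eqP; apply: eq_bigr => i _.
  have E : consistent a b (splice a b X Y) =1 consistent a b (splice a b X Y0).
    by apply: exit_states_consistent => //; rewrite Ym.
  by rewrite /ratio /cond_avg /class_size !(eq_bigl _ _ E).
by rewrite big_pred0.
Qed.

(** Each deficit is at most a mutual information by [Nln_half_le], and [sum_mul_cond_avg] turns that
    into the mean of [ln (ratio a b i (X i) X)]. These logarithms add up to
    [ln (block_ratio X X)]. *)
Lemma sum_deficit_le :
  \sum_(i < t | (a <= i < b)%N) deficit a b i <= ln (#|St| ^ ell)%:R.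
Proof.
have N0 := natr_card_str_gt0; have q0 := natr_cardV_gt0.
have St0 : (0 < #|St|)%N by apply/card_gt0P; exists init.
pose K : R := (#|St| ^ ell)%:R; have K0 : 0 < K by rewrite ltr0n expn_gt0 St0.
have pos i : (a <= i < b)%N -> deficit a b i <=
    (\sum_(X : str) ln (ratio a b i (X i) X)) / #|{: str}|%:R.
  move=> iab; rewrite ler_pdivrMr ?mulr_gt0// mulrA divfK ?gt_eqF//.
  have -> : (\sum_(X : str) ln (ratio a b i (X i) X)) * #|V|%:R =
      \sum_X \sum_x ratio a b i x X * ln (ratio a b i x X).
    rewrite mulr_suml exchange_big/=.
    transitivity (\sum_x \sum_X ln (ratio a b i x X) * density i x X).
      rewrite exchange_big/=; apply: eq_bigr => X _.
      by rewrite (sum_mul_density i X (fun x => ln (ratio a b i x X))) mulrC.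
    apply: eq_bigr => x _; rewrite -(sum_mul_cond_avg ab bT)//.
    - by apply: eq_bigr => X _; rewrite mulrC.
    - move=> X Y cXY /=; rewrite /ratio.
      by rewrite (invariant_cond_avg ab bT (c := a) (d := b)) ?leqnn ?orbT.
    - by move=> X Y XY; rewrite /density XY.
  apply: ler_sum => X _.
  apply: (@le_trans _ _ (\sum_x (ratio a b i x X * ln (ratio a b i x X)
                                  - 3 / 2 * (ratio a b i x X - 1)))).
    by apply: ler_sum => x _; apply/Nln_half_le/ratio_ge0.
  rewrite big_split/= sumrN -mulr_sumr big_split/= sum_ratio// sumrN sumr_const.
  by rewrite subrr mulr0 subr0.
apply: (le_trans (ler_sum _ pos)); rewrite -mulr_suml exchange_big/=.
rewrite ler_pdivrMr//.
(* Jensen's inequality through the tangent of [ln] at [K], which bounds the mean of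
   [block_ratio X X]. *)
apply: (@le_trans _ _ (\sum_X (block_ratio X X / K - 1 + ln K))).
  apply: ler_sum => X _; apply: (@le_trans _ _ (ln (block_ratio X X))); last first.
    apply: ln_le_scaled => //; apply: prodr_gt0 => i _; exact: ratio_self_gt0.
  by rewrite /block_ratio ln_prod// => i _; exact: ratio_self_gt0.
rewrite 2!big_split/= !sumr_const -mulr_suml -[ln K *+ _]mulr_natr.
rewrite gerDr mulNrn subr_le0 ler_pdivrMr//; exact: sum_block_ratio_diag.
Qed.

End BlockInformation.

(** * Likelihoods over several disjoint blocks *)

Section SeparatedBlocks.
Variables (lo hi : 'I_t -> nat).

Definition separated (P : {pred 'I_t}) :=
  {in P, forall i : 'I_t, (lo i <= i < hi i)%N && (hi i <= T)%N} /\
  {in P &, forall i j : 'I_t, i != j -> (hi i <= lo j)%N || (hi j <= lo i)%N}.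

(** Induction on [r]: the tail is treated with the average for [i] absorbed into [F]; then block [i]
    is exchanged, where [F] is invariant and the other factors read positions outside that block. *)
Lemma sum_mul_prod_cond_avg (r : seq 'I_t) (g : 'I_t -> V -> R) F :
  uniq r -> separated (mem r) -> {in r, forall i, invariant (lo i) (hi i) F} ->
  \sum_X F X * \prod_(i <- r) cond_avg (lo i) (hi i) (fun Y => g i (Y i)) X =
  \sum_X F X * \prod_(i <- r) g i (X i).
Proof.
elim: r F => [|i r IH] F /=; first by move=> *; apply: eq_bigr => X _; rewrite !big_nil.
move=> /andP[ir ur] [bnd sep] inv.
have bi := bnd i (mem_head i r).
have si (j : 'I_t) : j \in r -> (hi i <= lo j)%N || (hi j <= lo i)%N.
  move=> jr; apply: sep; rewrite ?mem_head ?in_cons ?jr ?orbT//.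
  by apply: contraNneq ir => ->.
have bj (j : 'I_t) : j \in r -> (lo j <= j < hi j)%N && (hi j <= T)%N.
  by move=> jr; apply: bnd; rewrite in_cons jr orbT.
transitivity (\sum_X (F X * cond_avg (lo i) (hi i) (fun Y => g i (Y i)) X) *
    \prod_(j <- r) g j (X j)).
  rewrite -IH//.
  - by apply: eq_bigr => X _; rewrite big_cons mulrA.
  - split; first by move=> j jr; apply: bj.
    by move=> j k jr kr; apply: sep; rewrite in_cons (jr, kr) orbT.
  - move=> j jr X Y cXY; rewrite inv ?in_cons ?jr ?orbT//.
    have := bj _ jr; have := si _ jr => ij jb.
    by rewrite (invariant_cond_avg _ _ (a := lo j) (b := hi j))//; lia.
transitivity (\sum_X (F X * \prod_(j <- r) g j (X j)) * g i (X i)); last first.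
  by apply: eq_bigr => X _; rewrite big_cons mulrAC mulrA.
rewrite -(@sum_mul_cond_avg (lo i) (hi i) _ _ (fun X => F X * \prod_(j <- r) g j (X j)));
  [|lia|lia| |].
- by apply: eq_bigr => X _; rewrite mulrAC.
- move=> X Y cXY /=; rewrite inv ?mem_head//; congr (_ * _).
  rewrite !big_seq; apply: eq_bigr => j jr; rewrite ffunE.
  by have := si _ jr; have := bj _ jr; case: ifP => //; lia.
- by move=> X Y XY; rewrite XY//; lia.
Qed.

(* Density of the stream in which each position of [S] independently receives
   the needle [x] with probability 1/2 and all other positions are uniform. *)
Definition half_planted (S : {set 'I_t}) x X : R :=
  \prod_(i in S) ((1 + density i x X) / 2).

Lemma sum_half_planted S x : \sum_X half_planted S x X = #|{: str}|%:R.
Proof.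
pose f i v : R := if i \in S then (1 + #|V|%:R * (v == x)%:R) / 2 else 1.
transitivity (\sum_(X : str) \prod_i f i (X i)).
  by apply: eq_bigr => X _; rewrite /half_planted big_mkcond.
rewrite -bigA_distr_bigA card_ffun natrX.
transitivity (\prod_(i < t) (#|V|%:R : R)); last by rewrite prodr_const.
apply: eq_bigr => i _; rewrite /f; case: (i \in S); last by rewrite sumr_const.
rewrite -mulr_suml big_split/= sumr_const (bigD1 x)//= eqxx big1 => [|v /negbTE->].
  by rewrite mulr1 addr0; field.
by rewrite mulr0.
Qed.

(* Gibbs' inequality for the likelihood [L] of the observed run:
   [ln (L * (1 + lam * G)) <= L * (1 + lam * G) - 1], averaged over uniform streams. *)
Lemma half_planted_bound (S : {set 'I_t}) x (G : St -> bool) (lam : R) :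
  0 <= lam -> separated (mem S) ->
  ln (1 + lam) * \sum_X (G (start X ell))%:R <=
  lam * (\sum_X (G (start X ell))%:R * half_planted S x X) +
  \sum_X \sum_(i in S) - ln ((1 + ratio (lo i) (hi i) i x X) / 2).
Proof.
move=> lam0 sep; have [bnd _] := sep.
pose w i v : R := 2^-1 + 2^-1 * (#|V|%:R * (v == x)%:R).
pose L X : R := \prod_(i <- enum S) cond_avg (lo i) (hi i) (fun Y => w i (Y i)) X.
have LE X : L X = \prod_(i in S) ((1 + ratio (lo i) (hi i) i x X) / 2).
  rewrite /L big_enum/=; apply: eq_bigr => i iS.
  have /andP[/andP[l1 l2] _] := bnd i iS.
  by rewrite cond_avg_affine; [rewrite /ratio /density; ring|lia].
have WE X : \prod_(i <- enum S) w i (X i) = half_planted S x X.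
  rewrite /half_planted big_enum/=; apply: eq_bigr => i iS.
  by rewrite /w /density; ring.
have pos X i : 0 < (1 + ratio (lo i) (hi i) i x X) / 2.
  by have := ratio_ge0 (lo i) (hi i) i x X; lra.
(* The final state is invariant under every block, so [L] and the true density give the same sum
   against any function of it. *)
have change (H : St -> R) :
    \sum_X H (start X ell) * L X = \sum_X H (start X ell) * half_planted S x X.
  rewrite sum_mul_prod_cond_avg ?enum_uniq//.
  - by apply: eq_bigr => X _; rewrite WE.
  - by split=> [i|i j]; rewrite !mem_enum; [apply: sep.1|apply: sep.2].
  - move=> i; rewrite mem_enum => iS; apply: invariant_start.
    + by have := bnd i iS; lia.
    + by have := bnd i iS; lia.
have lnL X : ln (L X) = - \sum_(i in S) - ln ((1 + ratio (lo i) (hi i) i x X) / 2).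
  by rewrite LE ln_prod ?sumrN ?opprK.
rewrite -lerBlDr -sumrN [X in X + _]mulr_sumr -big_split/=.
apply: (@le_trans _ _ (\sum_X (L X * (1 + lam * (G (start X ell))%:R) - 1))).
  apply: ler_sum => X _; rewrite -lnL.
  have L0 : 0 < L X by rewrite LE; apply: prodr_gt0 => i _.
  have G1 : 0 < 1 + lam * (G (start X ell))%:R by rewrite ltr_pwDl// mulr_ge0.
  apply: le_trans (ln_le_subr1 (mulr_gt0 L0 G1)).
  rewrite lnM ?posrE// addrC lerD2l.
  by case: (G _); rewrite ?mulr1 ?mulr0 ?addr0 ?ln1.
have := change (fun s => 1 + lam * (G s)%:R) => /=.
under eq_bigr do rewrite mulrC; move=> E.
rewrite big_split/= E; under eq_bigr do rewrite mulrDl mul1r -mulrA.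
rewrite big_split/= sum_half_planted -mulr_sumr sumrN sumr_const.
by rewrite addrAC subrr add0r.
Qed.

Lemma half_planted_avg_bound (S : {set 'I_t}) (G : St -> bool) (lam : R) :
  0 <= lam -> separated (mem S) ->
  ln (1 + lam) * (\sum_X (G (start X ell))%:R / #|{: str}|%:R) <=
  lam * ((\sum_x \sum_X (G (start X ell))%:R * half_planted S x X)
          / (#|{: str}|%:R * #|V|%:R)) +
  \sum_(i in S) deficit (lo i) (hi i) i.
Proof.
move=> lam0 sep; have N0 := natr_card_str_gt0; have q0 := natr_cardV_gt0.
have -> : \sum_(i in S) deficit (lo i) (hi i) i =
    (\sum_x \sum_X \sum_(i in S) - ln ((1 + ratio (lo i) (hi i) i x X) / 2))
      / (#|{: str}|%:R * #|V|%:R).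
  rewrite -mulr_suml exchange_big [in RHS]exchange_big/=; congr (_ / _).
  by apply: eq_bigr => X _; rewrite exchange_big.
rewrite (mulrA lam) -mulrDl ler_pdivlMr ?mulr_gt0//.
have -> : ln (1 + lam) * (\sum_X (G (start X ell))%:R / #|{: str}|%:R) *
    (#|{: str}|%:R * #|V|%:R) = \sum_(x : V) ln (1 + lam) * \sum_X (G (start X ell))%:R.
  by rewrite -mulr_suml sumr_const mulrA mulrA divfK ?gt_eqF// mulr_natr.
rewrite [X in _ <= X + _]mulr_sumr -big_split/=; apply: ler_sum => x _.
exact: half_planted_bound.
Qed.

End SeparatedBlocks.

(** * Dyadic blocks *)

Section Dyadic.
Variable d : nat.
Hypotheses (Td : T = (2 ^ d)%N) (tT : (t <= T)%N).

Definition dyadic_lo m i := (i %/ 2 ^ m * 2 ^ m)%N.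
Definition dyadic_hi m i := ((i %/ 2 ^ m).+1 * 2 ^ m)%N.

Definition isolated (S : {set 'I_t}) i m :=
  [forall j : 'I_t in S, (j %/ 2 ^ m == i %/ 2 ^ m)%N ==> (j == i)].

Definition level S i : nat := [arg max_(m > ord0 | isolated S i m) (m : 'I_d.+1)].

Lemma levelP S i : [/\ (level S i <= d)%N, isolated S i (level S i) &
  forall m, (m <= d)%N -> isolated S i m -> (m <= level S i)%N].
Proof.
rewrite /level; case: arg_maxnP => [|m im mmax].
  (* Intervals of level 0 are singletons, so [ord0] is an admissible level. *)
  by apply/forall_inP => j _; apply/implyP; rewrite !divn1.
split=> //; first by rewrite -ltnS.
by move=> k kd ik; apply: (mmax (Ordinal (kd : (k < d.+1)%N))).
Qed.

Lemma dyadic_mem m i : (dyadic_lo m i <= i < dyadic_hi m i)%N.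
Proof. by rewrite /dyadic_lo /dyadic_hi leq_divM ltn_ceil ?expn_gt0. Qed.

Lemma dyadic_index_lt m i : (m <= d)%N -> (i %/ 2 ^ m < 2 ^ (d - m))%N.
Proof.
move=> md; rewrite ltn_divLR ?expn_gt0// -expnD subnK// -Td.
exact: leq_trans (ltn_ord i) tT.
Qed.

Lemma dyadic_block_leT m k : (m <= d)%N -> (k < 2 ^ (d - m))%N -> (k.+1 * 2 ^ m <= T)%N.
Proof.
move=> md kd; have -> : T = (2 ^ (d - m) * 2 ^ m)%N by rewrite -expnD subnK.
by rewrite leq_mul2r kd orbT.
Qed.

Lemma dyadic_nested m k i : (m <= k)%N ->
  (dyadic_lo k i <= dyadic_lo m i)%N /\ (dyadic_hi m i <= dyadic_hi k i)%N.
Proof.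
move=> mk; have [e ->] : exists e, k = (m + e)%N by exists (k - m)%N; lia.
rewrite /dyadic_lo /dyadic_hi expnD divnMA; move: (i %/ 2 ^ m)%N => q.
rewrite !(mulnCA _ (2 ^ m)%N) !(mulnC _ (2 ^ m)%N) !leq_mul2l leq_divM orbT.
by split=> //; rewrite ltn_ceil ?expn_gt0// orbT.
Qed.

(** Dyadic intervals are nested or disjoint. If the level of [i] is at most that of [j], nesting
    would put [i] in the block of [j], which isolates [j]. *)
Lemma separated_level (S : {set 'I_t}) :
  separated (fun i => dyadic_lo (level S i) i) (fun i => dyadic_hi (level S i) i) (mem S).
Proof.
split=> [i _|].
  have [ld _ _] := levelP S i.
  by rewrite dyadic_mem dyadic_block_leT// dyadic_index_lt.
suff H : forall i j : 'I_t, i \in S -> j \in S -> i != j -> (level S i <= level S j)%N ->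
    (dyadic_hi (level S i) i <= dyadic_lo (level S j) j)%N ||
    (dyadic_hi (level S j) j <= dyadic_lo (level S i) i)%N.
  move=> i j iS jS ij; case: (leqP (level S i) (level S j)) => [|/ltnW] /H h.
    exact: h.
  by rewrite orbC; apply: h => //; rewrite eq_sym.
move=> i j iS jS ij lij; have [_ /forall_inP/(_ i iS) iso _] := levelP S j.
rewrite (negbTE ij) implybF in iso.
have [lo_le hi_le] := dyadic_nested i lij.
move: iso; rewrite neq_ltn => /orP[] h; apply/orP; [left|right].
  by apply: leq_trans hi_le _; rewrite leq_mul2r h orbT.
by apply: leq_trans _ lo_le; rewrite leq_mul2r h orbT.
Qed.

(** * Random selected sets and the distribution of levels *)

Definition bernoulli_set (r : R) (S : {set 'I_t}) : R :=
  \prod_i (if i \in S then r else 1 - r).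

Lemma bernoulli_set_ge0 r S : 0 <= r <= 1 -> 0 <= bernoulli_set r S.
Proof. by move=> /andP[r0 r1]; apply: prodr_ge0 => i _; case: ifP => _; rewrite ?subr_ge0. Qed.

(** Expand a product of sums of selected and unselected weights, the unselected weight being set to
    0 on [A]. *)
Lemma bernoulli_set_superset r (A : {set 'I_t}) :
  \sum_(S : {set 'I_t} | A \subset S) bernoulli_set r S = r ^+ #|A|.
Proof.
transitivity (\prod_(i < t) (r + (if i \in A then 0 else 1 - r))).
  rewrite bigA_distr big_mkcond; apply: eq_bigr => S _.
  case: ifP => [/fintype.subsetP AS|/negbT/fintype.subsetPn[i iA iS]].
    by apply: eq_bigr => i _; case: ifP => // /negbT iS; rewrite ifN//; apply: contra (AS i) iS.
  by rewrite (bigD1 i)//= (negbTE iS) iA mul0r.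
rewrite -prodr_const [RHS]big_mkcond; apply: eq_bigr => i _.
by case: ifP => _; rewrite ?addr0// subrKC.
Qed.

Lemma sum_bernoulli_set r : \sum_S bernoulli_set r S = 1.
Proof.
rewrite -[RHS](expr0 r) -(cards0 'I_t) -bernoulli_set_superset.
by apply: eq_bigl => S; rewrite finset.sub0set.
Qed.

(** No level above [d] forces a second element into [S], so only the event [i \in S] is kept. *)
Lemma level_top_prob r i : 0 <= r <= 1 ->
  \sum_(S : {set 'I_t} | (i \in S) && (level S i == d)) bernoulli_set r S <= r.
Proof.
move=> r01; rewrite -[leRHS]expr1 -(cards1 i) -bernoulli_set_superset.
rewrite big_mkcond [leRHS]big_mkcond; apply: ler_sum => S _.
by rewrite finset.sub1set; case: (i \in S) => //=; case: ifP => // _; exact: bernoulli_set_ge0.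
Qed.

Lemma card_dyadic_le m k : (#|[pred j : 'I_t | j %/ 2 ^ m == k]| <= 2 ^ m)%N.
Proof.
have sm : (0 < 2 ^ m)%N by rewrite expn_gt0.
pose f (j : 'I_t) : 'I_(2 ^ m) := Ordinal (ltn_pmod j sm).
rewrite -[leqRHS]card_ord -(@card_in_image _ _ f); first exact: max_card.
move=> i j; rewrite !inE => /eqP ik /eqP jk [ij]; apply: val_inj.
by rewrite /= (divn_eq i (2 ^ m)) (divn_eq j (2 ^ m)) ik jk ij.
Qed.

(* If the level of [i] is [m < d], another element of [S] lies in the dyadic
   interval of [i] at level [m + 1]. *)
Lemma level_prob r i m : 0 <= r <= 1 -> (m < d)%N ->
  \sum_(S : {set 'I_t} | (i \in S) && (level S i == m)) bernoulli_set r S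
  <= (2 ^ m.+1)%:R * r ^+ 2.
Proof.
move=> r01 md; have r0 : 0 <= r by case/andP: r01.
pose P := [pred j : 'I_t | (j %/ 2 ^ m.+1 == i %/ 2 ^ m.+1)%N].
apply: (@le_trans _ _ (\sum_(j : 'I_t | (j \in P) && (j != i)) \sum_(S : {set 'I_t} | [set i; j] \subset S)
                         bernoulli_set r S)).
  rewrite (exchange_big_dep xpredT)//= big_mkcond; apply: ler_sum => S _.
  have B0 := bernoulli_set_ge0 S r01.
  case: ifP => [/andP[iS /eqP lm]|_]; last by apply: sumr_ge0.
  have [_ _ lmax] := levelP S i.
  have : ~~ isolated S i m.+1 by apply/negP => /(lmax _ md); rewrite lm ltnn.
  rewrite negb_forall_in => /exists_inP[j jS]; rewrite negb_imply => /andP[jP ji].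
  rewrite (bigD1 j)/=; last by rewrite inE/= jP ji finset.subUset !finset.sub1set iS jS.
  by rewrite lerDl; apply: sumr_ge0.
rewrite (eq_bigr (fun=> r ^+ 2)); last first.
  by move=> j /andP[_ ji]; rewrite bernoulli_set_superset cards2 eq_sym ji.
rewrite sumr_const -[leLHS]mulr_natl ler_wpM2r ?sqr_ge0// ler_nat.
apply: (@leq_trans #|P|); last exact: card_dyadic_le.
by apply: subset_leq_card; apply/fintype.subsetP => j; rewrite !inE => /andP[].
Qed.

Lemma sum_deficit_level m : (m <= d)%N ->
  \sum_(i < t) deficit (dyadic_lo m i) (dyadic_hi m i) i
  <= (2 ^ (d - m))%:R * ln (#|St| ^ ell)%:R.
Proof.
move=> md.
rewrite (partition_big (fun i => Ordinal (dyadic_index_lt i md)) xpredT)//=.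
rewrite mulr_natl -[X in _ *+ X]card_ord -sumr_const; apply: ler_sum => k _.
have kT := dyadic_block_leT md (ltn_ord k).
apply: le_trans (sum_deficit_le (a := k * 2 ^ m) (b := k.+1 * 2 ^ m) _ kT); last first.
  by rewrite leq_mul2r leqnSn orbT.
rewrite le_eqVlt; apply/orP/or_introl/eqP; apply: eq_big => i; rewrite -val_eqE/=.
  apply/eqP/andP => [<-|[h1 h2]]; first by apply/andP/dyadic_mem.
  by apply/eqP; rewrite eqn_leq -ltnS ltn_divLR ?leq_divRL ?expn_gt0// h1 h2.
by move=> /eqP ik; rewrite /dyadic_lo /dyadic_hi ik.
Qed.

(** At level [m < d], the [2 ^ (d - m)] blocks and the probability bound [2 ^ m.+1 * r ^+ 2]
    multiply to a quantity independent of [m]. The top level, a single block, adds the term [r]. *)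
Lemma expected_deficit_le r : 0 <= r <= 1 ->
  \sum_S bernoulli_set r S *
     \sum_(i in S) deficit (dyadic_lo (level S i) i) (dyadic_hi (level S i) i) i
  <= (d%:R * (2 ^ d.+1)%:R * r ^+ 2 + r) * ln (#|St| ^ ell)%:R.
Proof.
move=> r01; have r0 : 0 <= r by case/andP: r01.
pose D (m : nat) (i : 'I_t) := deficit (dyadic_lo m i) (dyadic_hi m i) i.
have D0 m i : 0 <= D m i.
  by apply: deficit_ge0; have := dyadic_mem m i; lia.
have -> : \sum_S bernoulli_set r S * \sum_(i in S) D (level S i) i =
  \sum_(m < d.+1) \sum_i D m i *
     \sum_(S : {set 'I_t} | (i \in S) && (level S i == m)) bernoulli_set r S.
  under eq_bigr do rewrite mulr_sumr.
  rewrite (exchange_big_dep xpredT)//= [RHS]exchange_big/=; apply: eq_bigr => i _.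
  rewrite (partition_big (fun S => inord (level S i) : 'I_d.+1) xpredT)//=.
  apply: eq_bigr => m _; rewrite mulr_sumr; apply: eq_big => [S|S /andP[_ /eqP <-]].
    by rewrite -val_eqE/= inordK// ltnS; have [] := levelP S i.
  by rewrite inordK ?ltnS 1?mulrC//; have [] := levelP S i.
set Lam := ln _.
rewrite big_ord_recr/= mulrDl; apply: lerD; last first.
  apply: (@le_trans _ _ (\sum_i D d i * r)).
    by apply: ler_sum => i _; rewrite ler_wpM2l// level_top_prob.
  rewrite -mulr_suml mulrC ler_wpM2l//.
  by have := sum_deficit_level (leqnn d); rewrite subnn mul1r.
have -> : d%:R * (2 ^ d.+1)%:R * r ^+ 2 * Lam =
    \sum_(m < d) (2 ^ d.+1)%:R * r ^+ 2 * Lam.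
  by rewrite sumr_const card_ord -[RHS]mulr_natl !mulrA.
apply: ler_sum => m _.
apply: (@le_trans _ _ (\sum_i D m i * ((2 ^ m.+1)%:R * r ^+ 2))).
  by apply: ler_sum => i _; rewrite ler_wpM2l// level_prob.
rewrite -mulr_suml.
apply: (le_trans (ler_wpM2r _ (sum_deficit_level (ltnW (ltn_ord m))))).
  by rewrite mulr_ge0// sqr_ge0.
have -> : (2 ^ d.+1 = 2 ^ (d - m) * 2 ^ m.+1)%N.
  by rewrite -expnD; congr expn; have := ltn_ord m; lia.
move: (2 ^ (d - m))%N (2 ^ m.+1)%N => u v.
by rewrite natrM -/Lam le_eqVlt; apply/orP/or_introl/eqP; ring.
Qed.

Lemma bernoulli_needle_bound r (G : St -> bool) (lam : R) :
  0 <= r <= 1 -> 0 <= lam ->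
  ln (1 + lam) * (\sum_X (G (start X ell))%:R / #|{: str}|%:R) <=
  lam * (\sum_S bernoulli_set r S *
           ((\sum_x \sum_X (G (start X ell))%:R * half_planted S x X)
             / (#|{: str}|%:R * #|V|%:R)))
  + (d%:R * (2 ^ d.+1)%:R * r ^+ 2 + r) * ln (#|St| ^ ell)%:R.
Proof.
move=> r01 lam0.
apply: (le_trans _ (lerD (lexx _) (expected_deficit_le r01))).
rewrite -[leLHS]mul1r -[X in X * _ <= _](sum_bernoulli_set r) [leLHS]mulr_suml
  [X in _ <= X + _]mulr_sumr -big_split/=.
apply: ler_sum => S _; rewrite [X in _ <= X + _]mulrCA -mulrDr ler_wpM2l ?bernoulli_set_ge0//.
by apply: half_planted_avg_bound => //; exact: separated_level.
Qed.

End Dyadic.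

End Information.
End Passes.

(** * Planted streams *)

Section Streams.
Variables (n t : nat).
Hypothesis n_gt0 : (0 < n)%N.
Implicit Types (X Y : stream n t) (G : stream n t -> RR).

Let nR0 : n%:R != 0 :> RR. Proof. by rewrite pnatr_eq0 -lt0n. Qed.

Lemma sum_uniform_pmf : \sum_(X : stream n t) uniform_pmf X = 1.
Proof.
rewrite /uniform_pmf sumr_const card_ffun !card_ord -[LHS]mulr_natr natrX mulVf//.
by rewrite expf_neq0.
Qed.

Lemma sum_planted_pmf p : \sum_(X : stream n t) planted_pmf p X = 1.
Proof.
rewrite /planted_pmf -mulr_sumr exchange_big/=.
rewrite -[RHS](mulVf nR0); congr (_ * _).
transitivity (\sum_(x < n) (1 : RR)); last by rewrite sumr_const card_ord.
apply: eq_bigr => x _.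
rewrite -(bigA_distr_bigA (fun (i : 'I_t) (v : 'I_n) =>
   p * (v == x)%:R + (1 - p) * (n%:R)^-1 : RR)) big1// => i _.
rewrite big_split/= sumr_const card_ord -mulr_sumr (bigD1 x)//= eqxx big1.
  by rewrite addr0 mulr1 -[_ *+ n]mulr_natr mulfVK// subrKC.
by move=> v /negbTE ->.
Qed.

(** Positionwise, [2 * p * ((1 + density) / 2) + (1 - 2 * p)] equals [1 - p + p * density], the
    planted factor times [n]. *)
Lemma bernoulli_half_planted p G :
  \sum_(S : {set 'I_t}) bernoulli_set (2 * p) S *
    ((\sum_x \sum_X G X * half_planted RR S x X)
      / (#|{: stream n t}|%:R * #|'I_n|%:R)) =
  \sum_X planted_pmf p X * G X.
Proof.
under eq_bigr do rewrite mulrA mulr_sumr.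
rewrite -mulr_suml exchange_big/=.
transitivity ((\sum_(x < n) \sum_X G X *
   \sum_(S : {set 'I_t}) bernoulli_set (2 * p) S * half_planted RR S x X)
    / (#|{: stream n t}|%:R * #|'I_n|%:R)).
  congr (_ / _); apply: eq_bigr => x _.
  under eq_bigr do rewrite mulr_sumr; rewrite exchange_big/=.
  by apply: eq_bigr => X _; rewrite mulr_sumr; apply: eq_bigr => S _; rewrite mulrCA.
rewrite exchange_big/= mulr_suml; apply: eq_bigr => X _.
rewrite -mulr_sumr mulrC mulrCA mulrC; congr (_ * _).
rewrite card_ffun !card_ord natrX invfM mulrAC mulrC /planted_pmf; congr (_ * _).
rewrite mulr_sumr; apply: eq_bigr => x _.
transitivity (\prod_(i < t) ((n%:R)^-1 *
    (2 * p * ((1 + density RR i x X) / 2) + (1 - 2 * p)))).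
  rewrite big_split/= prodr_const card_ord exprVn; congr (_ * _).
  rewrite bigA_distr; apply: eq_bigr => S _.
  rewrite /bernoulli_set /half_planted [X in _ * X]big_mkcond -big_split/=.
  by apply: eq_bigr => i _; case: ifP => // _; rewrite mulr1.
apply: eq_bigr => i _; rewrite /density card_ord.
by field.
Qed.

Variables (s ell : nat) (Omega : finType) (A : streaming_alg n s Omega).

Lemma run_start w T X : (t <= T)%N ->
  run ell A w X = alg_out A w (start (alg_step A w) (alg_init A w) T X ell).
Proof.
move=> tT; rewrite /run /start; congr alg_out.
by elim: ell => //= k ->; rewrite segment_full.
Qed.

Lemma run_memoryless w X Y : ell = 0%N \/ s = 0%N -> run ell A w X = run ell A w Y.
Proof.
case=> [->//|s0]; rewrite /run; congr alg_out; apply: val_inj.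
have st0 (u : 'I_(2 ^ s)) : \val u = 0%N.
  by apply/eqP; rewrite -leqn0 -ltnS (leq_trans (ltn_ord u))// s0.
by rewrite !st0.
Qed.

Definition seed_success p w : RR :=
  1 / 2 * (\sum_(X : stream n t) uniform_pmf X * (~~ run ell A w X)%:R) +
  1 / 2 * (\sum_(X : stream n t) planted_pmf p X * (run ell A w X)%:R).

Lemma seed_success_rejects p w : seed_success p w =
  1 / 2 + 1 / 2 * (\sum_(X : stream n t) uniform_pmf X * (~~ run ell A w X)%:R
                    - \sum_(X : stream n t) planted_pmf p X * (~~ run ell A w X)%:R).
Proof.
rewrite /seed_success.
have -> : \sum_(X : stream n t) planted_pmf p X * (run ell A w X)%:R =
    1 - \sum_(X : stream n t) planted_pmf p X * (~~ run ell A w X)%:R.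
  rewrite -[X in X - _](sum_planted_pmf p) -sumrB; apply: eq_bigr => X _.
  by case: (run _ _ _ _) => /=; ring.
by ring.
Qed.

Lemma seed_success_memoryless p w : ell = 0%N \/ s = 0%N -> seed_success p w = 1 / 2.
Proof.
move=> deg; rewrite seed_success_rejects.
pose X0 : stream n t := [ffun=> Ordinal n_gt0].
under eq_bigr do rewrite (run_memoryless w _ X0 deg).
under [X in _ - X]eq_bigr do rewrite (run_memoryless w _ X0 deg).
by rewrite -!mulr_suml sum_uniform_pmf sum_planted_pmf subrr mulr0 addr0.
Qed.

Lemma seed_success_le p d w : 0 <= p <= 1 / 2 -> (t <= 2 ^ d)%N ->
  seed_success p w <= 4 / 7 +
    3 * ((d%:R * (2 ^ d.+1)%:R * (2 * p) ^+ 2 + 2 * p) * ((ell * s)%:R * ln 2)).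
Proof.
move=> p01 td; rewrite seed_success_rejects.
have r01 : 0 <= 2 * p <= 1 by lra.
have V0 : (0 < #|'I_n|)%N by rewrite card_ord.
(* With [lam = 1/6] and [ln (7/6) >= 1/7], rejection probabilities [a] (uniform) and [b] (planted)
   satisfy [a / 7 <= b / 6 + K]. So [a - b <= 1/7 + 6 * K], and [1/2 + 1/14 = 4/7] stays below
   [2/3]. *)
have l0 : 0 <= 6^-1 :> RR by lra.
have := bernoulli_needle_bound (alg_step A w) (alg_init A w) ell V0 (erefl (2 ^ d)%N) td
  (fun st => ~~ alg_out A w st) r01 l0.
rewrite (bernoulli_half_planted p (fun X =>
  (~~ alg_out A w (start (alg_step A w) (alg_init A w) (2 ^ d) X ell))%:R)).
under eq_bigr do rewrite -run_start//.
under [X in _ * X + _]eq_bigr do rewrite -run_start//.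
have -> : \sum_(X : stream n t) (~~ run ell A w X)%:R / #|{: stream n t}|%:R =
    \sum_(X : stream n t) uniform_pmf X * (~~ run ell A w X)%:R :> RR.
  by apply: eq_bigr => X _; rewrite mulrC /uniform_pmf card_ffun !card_ord natrX.
have -> : ln (#|'I_(2 ^ s)| ^ ell)%:R = (ell * s)%:R * ln 2 :> RR.
  by rewrite card_ord -expnM natrX lnXn// mulnC mulr_natl.
set a := \sum_(X : stream n t) uniform_pmf _ * _; set b := \sum_(X : stream n t) planted_pmf _ _ * _.
set K := _ * (_ * ln 2).
have a0 : 0 <= a by apply: sumr_ge0 => X _; rewrite mulr_ge0// invr_ge0 exprn_ge0.
have a1 : a <= 1.
  rewrite -[leRHS]sum_uniform_pmf; apply: ler_sum => X _.
  by rewrite ler_piMr ?invr_ge0 ?exprn_ge0// lern1 leq_b1.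
have : 1 - (1 + 6^-1)^-1 <= ln (1 + 6^-1 : RR) by apply: ln_ge_subV; lra.
have -> : 1 - (1 + 6^-1)^-1 = 7^-1 :> RR by field.
move=> /(ler_wpM2r a0) h1 h2; lra.
Qed.

End Streams.

Lemma success_prob_le (n s t ell : nat) (Omega : finType) (A : streaming_alg n s Omega)
    (mu : Omega -> RR) (p u : RR) :
  is_distr mu -> (forall w, seed_success t ell A p w <= u) ->
  success_prob t ell A mu p <= u.
Proof.
move=> [mu0 mu1] hu; rewrite -[u]mul1r -mu1 mulr_suml; apply: ler_sum => w _.
by rewrite ler_wpM2l//; exact: hu.
Qed.

Lemma trunc_log_le_log2 (t : nat) : (0 < t)%N -> (trunc_log 2 t)%:R <= log2 t%:R.
Proof.
move=> t0; have l2 : 0 < ln 2 :> RR by rewrite ln_gt0 ?ltr1n.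
rewrite /log2 ler_pdivlMr// mulr_natl -lnXn// ler_ln ?posrE ?exprn_gt0 ?ltr0n//.
by rewrite -natrX ler_nat trunc_logP.
Qed.

Theorem mainTheorem1 :
  exists C c : RR, 0 < C /\ 0 < c /\
  forall (n t : nat) (p : RR), (2 <= n)%N -> (2 <= t)%N ->
    (t%:R)^-1 <= p -> p <= 1 ->
    C * (t%:R) ^+ 2 <= n%:R ->
  forall (ell s : nat) (Omega : finType) (A : streaming_alg n s Omega)
         (mu : Omega -> RR),
    distinguishes t ell A mu p (1 / 3) ->
    c <= ell%:R * p ^+ 2 * s%:R * t%:R * log2 t%:R.
Proof.
(* The final inequality is [2/3 <= 4/7 + 3 * 34 * Q] for the quantity [Q] to be bounded, so
   [Q >= 1/1071]. *)
exists 1, 1224^-1; split; first by lra.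
split; first by rewrite invr_gt0 ltr0n.
move=> n t p n2 t2 tp p1 _ ell s Omega A mu [mud succ].
have n0 : (0 < n)%N by apply: leq_trans n2.
have t0 : (0 < t)%N by apply: leq_trans t2.
have tR : 2 <= t%:R :> RR by rewrite (ler_nat RR 2).
pose k := trunc_log 2 t; have kl := trunc_log_le_log2 t0.
have k1 : 1 <= k%:R :> RR by rewrite ler1n trunc_log_max.
set L := log2 t%:R in kl *; have L1 : 1 <= L by apply: le_trans k1 kl.
have p0 : 0 < p by apply: lt_le_trans tp; rewrite invr_gt0; lra.
have pt : 1 <= p * t%:R by rewrite -ler_pdivrMr ?div1r//; lra.
(* Without passes or memory the output ignores the stream and succeeds with probability only
   [1/2]. *)
have sdeg : ~ (ell = 0%N \/ s = 0%N).
  move=> deg; have half w : seed_success t ell A p w <= 1 / 2.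
    by rewrite seed_success_memoryless.
  by have := le_trans succ (success_prob_le mud half); lra.
have es1 : 1 <= (ell * s)%:R :> RR by rewrite ler1n muln_gt0; lia.
have -> : ell%:R * p ^+ 2 * s%:R * t%:R * L = (ell * s)%:R * (p * (p * t%:R) * L).
  by rewrite natrM; ring.
have e0 := le_trans ler01 es1.
have pq0 : 0 < p * (p * t%:R) by apply: mulr_gt0; lra.
have pqL : p * (p * t%:R) <= p * (p * t%:R) * L by rewrite ler_peMr// ltW.
have ppq : p <= p * (p * t%:R) by rewrite ler_peMr// ltW.
(* The selection probability [2 * p] must not exceed 1. For larger [p], the quantity is at least
   [p > 1/2] outright. *)
have [p_le|p_gt] := leP p (1 / 2); last first.
  have : p * (p * t%:R) * L <= (ell * s)%:R * (p * (p * t%:R) * L).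
    by rewrite ler_peMl//; lra.
  by lra.
have td : (t <= 2 ^ k.+1)%N by apply/ltnW/trunc_log_ltn.
have p01 : 0 <= p <= 1 / 2 by rewrite ltW.
have := le_trans succ (success_prob_le mud (fun w => seed_success_le n0 ell A w p01 td)).
have l2 : 0 <= ln 2 :> RR by rewrite ln_ge0// ler1n.
have l2' : ln 2 <= 1 :> RR by have := @ln_le_subr1 RR 2; lra.
have e2 : (ell * s)%:R * ln 2 <= (ell * s)%:R :> RR by rewrite ler_piMr.
have dL : k.+1%:R <= 2 * L by rewrite -natr1; lra.
have d2 : (2 ^ k.+2)%:R <= 4 * t%:R :> RR.
  by rewrite -natrM ler_nat !expnS mulnA leq_mul2l trunc_logP.
have dd : k.+1%:R * (2 ^ k.+2)%:R <= 2 * L * (4 * t%:R) by apply: ler_pM.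
(* The constant is [32 + 2]: 32 from the levels below the top, 2 from the top level via
   [p <= p * (p * t%:R) * L]. *)
have D : k.+1%:R * (2 ^ k.+2)%:R * (2 * p) ^+ 2 + 2 * p <= 34 * (p * (p * t%:R) * L).
  have := ler_wpM2r (sqr_ge0 (2 * p)) dd.
  have -> : 2 * L * (4 * t%:R) * (2 * p) ^+ 2 = 32 * (p * (p * t%:R) * L) by ring.
  by lra.
have K : (k.+1%:R * (2 ^ k.+2)%:R * (2 * p) ^+ 2 + 2 * p) * ((ell * s)%:R * ln 2)
    <= 34 * (p * (p * t%:R) * L) * (ell * s)%:R.
  apply: ler_pM => //; last by rewrite mulr_ge0.
  by rewrite addr_ge0 ?mulr_ge0 ?sqr_ge0//; lra.
have E : 34 * (p * (p * t%:R) * L) * (ell * s)%:R =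
  34 * ((ell * s)%:R * (p * (p * t%:R) * L)) by ring.
rewrite E in K; lra.
Qed.
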